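(* Every closed-disk drawable subset of $\mathbb{R}^2$ is Lebesgue measurable. Not every Lebesgue measurable subset of $\mathbb{R}^2$ is closed-disk drawable, but the collection $\mathcal{D}_{\le}$ of closed-disk drawable sets has the same cardinality as the collection of Lebesgue measurable subsets of $\mathbb{R}^2$. In particular, $|\mathcal{D}_{\le}|>|\mathcal{D}|$.
   Context: For $A\subseteq\mathbb{R}^2$ let $N(A)=\{x\in\mathbb{R}^2: |x-a|<1 \text{ for some } a\in A\}$ and $N_{\le}(A)=\{x\in\mathbb{R}^2: |x-a|\le 1 \text{ for some } a\in A\}$. Let $\mathcal{D}_1=\{N(A_1): A_1\subseteq\mathbb{R}^2\}$ and for $n\ge 2$ let $\mathcal{D}_n=\{D\cup N(A_n): D\in\mathcal{D}_{n-1}, A_n\subseteq\mathbb{R}^2\}$ if $n$ is odd and $\mathcal{D}_n=\{D\setminus N(A_n): D\in\mathcal{D}_{n-1}, A_n\subseteq\mathbb{R}^2\}$ if $n$ is even. The collection of drawable sets is $\mathcal{D}=\bigcup_{n\ge1}\mathcal{D}_n$. The collection $\mathcal{D}_{\le}$ of closed-disk drawable sets is defined in the same way with every $N(\cdot)$ replaced by $N_{\le}(\cdot)$. A Lebesgue set is a set differing from a Borel set by a subset of a Lebesgue-null set. *)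

(* Defs.v *)
From HB Require Import structures.
From mathcomp Require Import all_boot all_order all_algebra.
From mathcomp Require Import all_classical all_reals all_analysis.
Set Implicit Arguments. Unset Strict Implicit. Unset Printing Implicit Defensive.
Import Order.TTheory GRing.Theory Num.Theory.
Local Open Scope classical_set_scope.
Local Open Scope ring_scope.

Section Drawable.
Variable R : realType.

(* Euclidean distance in R^2 (note: the canonical norm on R*R is the max norm) *)
Definition edist (x a : R * R) : R :=
  Num.sqrt ((x.1 - a.1) ^+ 2 + (x.2 - a.2) ^+ 2).

Definition Nopen (A : set (R * R)) : set (R * R) :=
  [set x | exists2 a, A a & edist x a < 1].

Definition Nclosed (A : set (R * R)) : set (R * R) :=
  [set x | exists2 a, A a & edist x a <= 1].

(* Dlevel Nb n = D_{n+1}: D_1 = {Nb A}, D_k = {D u Nb A} for k odd,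
   {D \ Nb A} for k even. *)
Fixpoint Dlevel (Nb : set (R * R) -> set (R * R)) (n : nat)
    : set (set (R * R)) :=
  match n with
  | 0 => [set S | exists A, S = Nb A]
  | m.+1 => [set S | exists D, exists A, Dlevel Nb m D /\
              S = (if odd m then D `|` Nb A else D `\` Nb A)]
  end.

Definition drawable : set (set (R * R)) :=
  [set S | exists n, Dlevel Nopen n S].

Definition closed_drawable : set (set (R * R)) :=
  [set S | exists n, Dlevel Nclosed n S].

(* Borel sets of R^2 = product sigma-algebra of Borel(R) x Borel(R) *)
Definition mR2 := (measurableTypeR R * measurableTypeR R)%type.

Definition borel2 (B : set (R * R)) : Prop := measurable (B : set mR2).

Definition lebesgue2 : set mR2 -> \bar R :=
  (@lebesgue_measure R \x @lebesgue_measure R)%E.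

Definition lebesgue_set : set (set (R * R)) :=
  [set A | exists2 B, borel2 B &
     lebesgue2.-negligible ((A `\` B) `|` (B `\` A) : set mR2)].

End Drawable.
Arguments drawable R : clear implicits.
Arguments closed_drawable R : clear implicits.
Arguments lebesgue_set R : clear implicits.

(* Main.v *)
(** The set N_<=(A) minus N(A) consists of points x with an a in A at distance
    exactly 1.  One of the two coordinates of a - x exceeds 1/2 in absolute
    value, and moving x by less than 1 in that coordinate direction leads into
    N(A).  Hence these points form four sets whose slices in that direction are
    1-separated, so countable, and by Fubini N_<=(A) differs from the open set
    N(A) by a null set.

    If neither S nor its complement contains a closed unit disk, every step of a
    drawing of S must be trivial, which is absurd; the vertical lines with integer
    abscissa form such a set.

    For T a set of reals, (t, 1) lies in N_<=(T x {0}) iff t is in T, so there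
    are as many closed-disk drawable sets as sets of points; whereas an open-disk
    drawing is a finite sequence of open sets, each coded by a set of naturals, so
    there are at most continuum many of them. *)
Require Import Defs.
From mathcomp Require Import all_boot all_order all_algebra.
From mathcomp Require Import all_classical all_reals all_analysis.
From mathcomp Require Import zify lra.
Set Implicit Arguments. Unset Strict Implicit. Unset Printing Implicit Defensive.
Import Order.TTheory GRing.Theory Num.Theory.
Import numFieldNormedType.Exports.
Local Open Scope classical_set_scope.
Local Open Scope ring_scope.
Local Open Scope card_scope.

(** * Cantor's theorem; coding sets of naturals and points of the plane by reals *)

Section Cardinality.

Lemma injective_card_le T U (f : T -> U) (B : set U) :
  injective f -> (forall x, B (f x)) -> [set: T] #<= B.
Proof.
move=> fI fB; have /card_eqPle[_ Tf] := inj_card_eq (in2W fI : {in [set: T] &, _}).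
by apply: card_le_trans Tf (subset_card_le _) => _ [x _ <-].
Qed.

Lemma injective_image T U (f : T -> U) :
  injective f -> injective (fun A : set T => f @` A).
Proof.
move=> fI A B AB; apply/funext => x.
by rewrite -(image_inj (A := A) fI) -(image_inj (A := B) fI) AB.
Qed.

Lemma injective_pickle (T : countType) :
  injective (fun A : set T => pickle @` A).
Proof. exact: injective_image (pcan_inj (@pickleK T)). Qed.

Lemma Cantor (T : pointedType) : ~ ([set: set T] #<= [set: T]).
Proof.
(* [D] collects the codes [f A] that lie outside the set [A] they code. *)
move=> /ppcard_leP[f]; pose D := [set x | exists2 A, f A = x & ~ A x].
have nD : ~ D (f D).
  by move=> D0; have [A /inj-> //] := D0; rewrite inE.
by apply: (nD); exists D.
Qed.

Variable R : realType.

(** Digits 0 and 1 in base 3 determine the set, which base 2 would not ensure. The partial sums are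
    nondecreasing, so a supremum serves as their limit. *)
Definition ternary_sum (A : set nat) (n : nat) : R :=
  \sum_(i < n | `[< A i >]) 3^-1 ^+ i.

Definition ternary (A : set nat) : R := sup (range (ternary_sum A)).

Lemma ternary_sumS A n :
  ternary_sum A n.+1 = ternary_sum A n + (if `[< A n >] then 3^-1 ^+ n else 0).
Proof. by rewrite /ternary_sum big_mkcond big_ord_recr/= -big_mkcond. Qed.

Lemma ternary_sum_le A m n : (m <= n)%N -> ternary_sum A m <= ternary_sum A n.
Proof.
move=> /subnK <-; elim: (n - m)%N => [|k IH]; first by rewrite add0n.
rewrite addSn ternary_sumS; apply: (le_trans IH); rewrite lerDl.
by case: ifP => // _; rewrite exprn_ge0// invr_ge0.
Qed.

(** Comparison with a geometric sum; keeping its exact value, with the last power subtracted, lets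
    the induction close. *)
Lemma ternary_sum_tail A k n :
  ternary_sum A (k + n) <=
  ternary_sum A k + 3 / 2 * (3^-1 ^+ k - 3^-1 ^+ (k + n)).
Proof.
elim: n => [|n IH]; first by rewrite addn0; lra.
rewrite addnS ternary_sumS exprS; have : 0 <= (3^-1 : R) ^+ (k + n).
  by rewrite exprn_ge0// invr_ge0.
by move: IH; case: ifP => _; lra.
Qed.

Lemma ternary_sum_ub A k n :
  ternary_sum A n <= ternary_sum A k + 3 / 2 * 3^-1 ^+ k.
Proof.
have p3 i : 0 <= (3^-1 : R) ^+ i by rewrite exprn_ge0// invr_ge0.
have [nk|kn] := leqP n k.
  by apply: le_trans (ternary_sum_le A nk) _; rewrite lerDl; have := p3 k; lra.
rewrite -(subnKC (ltnW kn)).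
apply: le_trans (ternary_sum_tail _ _ _) _.
by rewrite lerD2l; have := p3 (k + (n - k))%N; lra.
Qed.

(** At the first index [k] where two sets differ, the one containing [k] gains [3^-1 ^+ k], while
    all later terms of the other add up to at most half of that. *)
Lemma ternary_inj : injective ternary.
Proof.
have p3 i : 0 < (3^-1 : R) ^+ i by rewrite exprn_gt0// invr_gt0.
have lt A B k : (forall i, (i < k)%N -> A i <-> B i) -> A k -> ~ B k ->
    ternary B < ternary A.
  move=> AB Ak Bk.
  have ABk : ternary_sum A k = ternary_sum B k.
    apply: eq_bigl => i; have [AB1 AB2] := AB i (ltn_ord i).
    by apply: asbool_equiv_eq; split.
  (* The added term equals [3 / 2 * 3^-1 ^+ k.+1], the bound on the tail after [k]. *)
  apply: (@le_lt_trans _ _ (ternary_sum B k + 2^-1 * 3^-1 ^+ k)).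
    apply: ge_sup; first by exists (ternary_sum B 0), 0.
    move=> _ [n _ <-]; apply: le_trans (ternary_sum_ub B k.+1 n) _.
    by rewrite ternary_sumS asboolF// exprS; have := p3 k; lra.
  apply: (@lt_le_trans _ _ (ternary_sum A k.+1)).
    by rewrite ternary_sumS asboolT// ABk; have := p3 k; lra.
  apply: ub_le_sup; last by exists k.+1.
  exists (ternary_sum A 0 + 3 / 2 * 3^-1 ^+ 0) => _ [n _ <-].
  exact: ternary_sum_ub.
move=> A B eqAB; apply/eqP/negP => /negP/eqP nAB.
have : exists k, `[< A k >] != `[< B k >].
  apply: contrapT => /forallNP AB; apply: nAB; apply/funext => k; apply/propext.
  by apply: asbool_eq_equiv; apply/eqP; have /negP := AB k; rewrite negbK.
move=> /ex_minnP[k kAB kmin].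
have AB i : (i < k)%N -> A i <-> B i.
  move=> ik; apply: asbool_eq_equiv; apply/eqP/negP => /negP/kmin.
  by rewrite leqNgt ik.
have [Ak|Ak] := pselect (A k); have [Bk|Bk] := pselect (B k).
- by move: kAB; rewrite !asboolT.
- by have := lt A B k AB Ak Bk; rewrite eqAB ltxx.
- have /(_ Bk Ak) := lt B A k (fun i ik => iff_sym (AB i ik)).
  by rewrite eqAB ltxx.
- by move: kAB; rewrite !asboolF.
Qed.

Lemma rat_cut_inj : injective (fun x : R => [set q : rat | ratr q < x]).
Proof.
have lt (x y : R) :
    [set q : rat | ratr q < x] = [set q : rat | ratr q < y] -> ~ x < y.
  move=> xy /rat_in_itvoo[q]; rewrite in_itv/= => /andP[xq qy].
  by have : [set q : rat | ratr q < y] q := qy; rewrite -xy/= ltNge (ltW xq).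
move=> x y xy; apply/eqP; rewrite eq_le !leNgt.
by apply/andP; split; apply/negP; apply: lt.
Qed.

(** Each coordinate becomes its cut in the rationals, the two cuts form one subset of [rat + rat],
    and [pickle] followed by [ternary] turns this subset into a real. *)
Lemma plane_embeds_in_line : exists f : R * R -> R, injective f.
Proof.
pose cut (x : R) := [set q : rat | ratr q < x].
pose g (x : R * R) := [set s : rat + rat |
  match s with inl q => cut x.1 q | inr q => cut x.2 q end].
exists (fun x => ternary (pickle @` g x)).
move=> [a b] [c d] /ternary_inj/injective_pickle e; congr (_, _).
- by apply: rat_cut_inj; apply/funext => q; exact: (congr1 (fun S => S (inl q)) e).
- by apply: rat_cut_inj; apply/funext => q; exact: (congr1 (fun S => S (inr q)) e).
Qed.

End Cardinality.

(** * Euclidean distance, open sets and rational rectangles *)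

Section Plane.
Variable R : realType.
Local Notation dist := (@Defs.edist R).
Implicit Types (x y a : R * R) (A U : set (R * R)).

Lemma edist_lt x a r :
  0 < r -> (dist x a < r) = ((x.1 - a.1) ^+ 2 + (x.2 - a.2) ^+ 2 < r ^+ 2).
Proof.
move=> r0; by rewrite -[X in dist _ _ < X](gtr0_norm r0) -sqrtr_sqr ltr_sqrt// exprn_gt0.
Qed.

Lemma edist_le x a r :
  0 <= r -> (dist x a <= r) = ((x.1 - a.1) ^+ 2 + (x.2 - a.2) ^+ 2 <= r ^+ 2).
Proof.
move=> r0; rewrite -[X in dist _ _ <= X](ger0_norm r0) -sqrtr_sqr ler_sqrt//.
exact: exprn_ge0.
Qed.

Lemma edistxx x : dist x x = 0.
Proof. by rewrite /Defs.edist !subrr expr0n/= addr0 sqrtr0. Qed.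

Lemma Nopen_sub_Nclosed A : Nopen A `<=` Nclosed A.
Proof. by move=> x [a Aa /ltW]; exists a. Qed.

Lemma continuous_edist a : continuous (dist^~ a : R * R -> R).
Proof.
move=> x; apply: continuous_comp; last exact: sqrt_continuous.
by apply: (@cvgD _ (R : normedModType R)); apply: cvgM; apply: cvgB;
  do ?[exact: cvg_fst|exact: cvg_snd|exact: cvg_cst].
Qed.

Lemma open_edist_lt a r : open [set x | dist x a < r].
Proof.
apply: (@open_comp _ _ (dist^~ a) [set s | s < r]) => [x _|]; last exact: open_lt.
exact: continuous_edist.
Qed.

Lemma open_Nopen A : open (Nopen A).
Proof.
rewrite (_ : Nopen A = \bigcup_(a in A) [set x | dist x a < 1]) //.
by apply: bigcup_open => a _; exact: open_edist_lt.
Qed.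

(** The index type is countable: this makes open sets Borel, and later codes them by sets of
    naturals. *)
Definition rat_rect (q : (rat * rat) * (rat * rat)) : set (R * R) :=
  `]ratr q.1.1, ratr q.1.2[%classic `*` `]ratr q.2.1, ratr q.2.2[%classic.

Lemma open_rat_rect U : open U ->
  U = \bigcup_(q in [set q | rat_rect q `<=` U]) rat_rect q.
Proof.
move=> oU; apply/seteqP; split=> [[x y] Uxy|x [q qU qx]]; last exact: qU.
(* Balls of the product are squares, so rational endpoints within [e] of each coordinate suffice. *)
have [/= e e0 eU] : nbhs_ball (x, y) U by apply/nbhs_ballP; exact: oU.
have [p1 /[!in_itv]/= /andP[p1l p1r]] := @rat_in_itvoo R (x - e) x ltac:(lra).
have [p2 /[!in_itv]/= /andP[p2l p2r]] := @rat_in_itvoo R x (x + e) ltac:(lra).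
have [p3 /[!in_itv]/= /andP[p3l p3r]] := @rat_in_itvoo R (y - e) y ltac:(lra).
have [p4 /[!in_itv]/= /andP[p4l p4r]] := @rat_in_itvoo R y (y + e) ltac:(lra).
exists ((p1, p2), (p3, p4)); last by split; rewrite /= in_itv/= ?p1r ?p2l ?p3r ?p4l.
move=> [u v] [/=]; rewrite !in_itv/= => /andP[u1 u2] /andP[v1 v2].
by apply: eU; split; rewrite /ball/= ltr_norml; apply/andP; split; lra.
Qed.

Lemma open_borel2 U : open U -> borel2 U.
Proof.
move=> /open_rat_rect ->; rewrite /borel2 bigcup_mkcond.
apply: countable_bigcupT_measurable => [|q]; first exact: countableP.
by case: ifP => // _; apply: measurableX; exact: measurable_itv.
Qed.

End Plane.

(** * Null boundaries and Lebesgue measurability *)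

Section Measurability.
Variable R : realType.
Local Notation dist := (@Defs.edist R).
Local Notation mu := (@lebesgue2 R).
Implicit Types (x y a : R * R) (A U : set (R * R)).

(** Two reals with the same floor differ by less than 1, so the floor is injective on [S]. *)
Lemma separated_countable (S : set R) :
  (forall s t, 0 < t < 1 -> S s -> ~ S (s + t)) -> countable S.
Proof.
move=> sep; have fI : {in S &, injective (@Num.floor R)}.
  have lt s t : S s -> S t -> Num.floor s = Num.floor t -> ~ s < t.
    move=> Ss St st slt; have /andP[s1 _] := real_floor_itv (num_real s).
    have /andP[_ t2] := real_floor_itv (num_real t).
    rewrite -st intrD in t2.
    apply: (sep s (t - s)) => //; last by rewrite addrC subrK.
    by apply/andP; split; lra.
  move=> s t /set_mem Ss /set_mem St st; apply/eqP.
  by rewrite eq_le !leNgt; apply/andP; split; apply/negP; apply: lt.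
by rewrite -(eq_countable (inj_card_eq fI)).
Qed.

Lemma countable_xsections_null U : borel2 U ->
  (forall s, countable [set t | U (s, t)]) -> mu U = 0%E.
Proof.
move=> mU cU; apply: integral0_eq => s _ /=.
apply: countable_lebesgue_measure0; apply: sub_countable (cU s).
by apply: subset_card_le => t; rewrite /xsection/= inE.
Qed.

(** The product measure integrates over x-sections; by uniqueness it agrees with the measure that
    integrates over y-sections. *)
Lemma countable_ysections_null U : borel2 U ->
  (forall t, countable [set s | U (s, t)]) -> mu U = 0%E.
Proof.
move=> mU cU.
rewrite /lebesgue2
  (@product_measure_unique _ _ _ _ R lebesgue_measure lebesgue_measure
    (lebesgue_measure \x^ lebesgue_measure)%E)//; last first.
  by move=> A B mA mB; exact: product_measure2E.
apply: integral0_eq => s _ /=.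
apply: countable_lebesgue_measure0; apply: sub_countable (cU s).
by apply: subset_card_le => t; rewrite /ysection/= inE.
Qed.

(* The points x outside N(A) with some a in A at distance 1 and phi x < phi a - 1/2
   need not form a Borel set; asking only for approximate such a gives a
   countable intersection of open sets. *)
Definition edge (phi : R * R -> R) A : set (R * R) :=
  ~` Nopen A `&` \bigcap_n [set x | exists2 a, A a &
    dist x a < 1 + n.+1%:R^-1 /\ phi x < phi a - 2^-1].

Lemma edge_borel2 phi A : continuous phi -> borel2 (edge phi A).
Proof.
move=> cphi; apply: (@measurableI _ (mR2 R)).
  by apply: measurableC; apply: open_borel2; exact: open_Nopen.
apply: (@bigcap_measurableType _ (mR2 R)) => // n _.
apply: open_borel2.
rewrite [X in open X](_ : _ = \bigcup_(a in A)
    ([set x | dist x a < 1 + n.+1%:R^-1] `&`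
     phi @^-1` [set s | s < phi a - 2^-1])) //.
apply: bigcup_open => a _; apply: openI; first exact: open_edist_lt.
by apply: open_comp => [x _|]; [exact: cphi|exact: open_lt].
Qed.

(* Used with y = x shifted by t along the coordinate phi: with v < -1/2 that
   coordinate of x - a, the squared distance to a changes by
   2 v t + t^2 < t^2 - t < 0. *)
Lemma edge_shift phi A x y (t : R) : 0 < t < 1 -> edge phi A x ->
  (forall a, phi x < phi a - 2^-1 ->
    (y.1 - a.1) ^+ 2 + (y.2 - a.2) ^+ 2 <
    (x.1 - a.1) ^+ 2 + (x.2 - a.2) ^+ 2 - t + t ^+ 2) ->
  ~ edge phi A y.
Proof.
move=> /andP[t0 t1] [_ Ex] xy [nNy _]; apply: nNy.
(* Since [e < 1], [(1 + e) ^+ 2 < 1 + 3 * e], and [3 * e] is exactly the decrease [t - t ^+ 2] of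
   the squared distance. So an [a] at distance less than [1 + e] from [x] is at distance less than 1
   from [y]. *)
pose e := (t - t ^+ 2) / 3; have t2 : 0 < t ^+ 2 by rewrite exprn_gt0.
have e0 : 0 < e by rewrite divr_gt0// subr_gt0 expr2 gtr_pMr.
have e1 : e < 1 by rewrite /e; lra.
have [n /=] := @ltr_add_invr R 1 (1 + e) ltac:(lra); rewrite ltrD2l => ne.
have n0 : 0 < n.+1%:R^-1 :> R by rewrite invr_gt0.
have [a Aa [xa xa1]] := Ex n I; exists a => //.
rewrite edist_lt//; apply: lt_le_trans (xy _ xa1) _.
move: xa; rewrite edist_lt ?addr_gt0// => xa.
have : (1 + n.+1%:R^-1) ^+ 2 < 1 + 3 * e :> R.
  by rewrite expr2; move: (n.+1%:R^-1) n0 ne => i i0 ie; nra.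
have -> : 3 * e = t - t ^+ 2 by rewrite mulrC divfK.
move: xa; rewrite expr1n.
by move: ((1 + _) ^+ 2) (_ ^+ 2 + _ ^+ 2) (t ^+ 2) => b c d cb bt; lra.
Qed.

Lemma edge_fst_null A (s : R) : `|s| = 1 -> mu (edge (fun x => s * x.1) A) = 0%E.
Proof.
move=> s1; apply: countable_ysections_null.
  apply: edge_borel2 => x; apply: cvgM; [exact: cvg_cst|exact: cvg_fst].
move=> v; apply: separated_countable => u t t01.
have [s0|s0] : s = 1 \/ s = -1 by move: s1; case: ger0P; lra.
  move=> Eu; apply: (edge_shift t01 Eu) => a /=; rewrite s0.
  by case/andP: t01; nra.
(* For [s = -1] the nearby centre lies on the other side, so the shift goes from [u + t] down to
   [u]. *)
move=> Eu Ev; apply: (edge_shift t01 Ev _ Eu) => a /=; rewrite s0.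
by case/andP: t01; nra.
Qed.

Lemma edge_snd_null A (s : R) : `|s| = 1 -> mu (edge (fun x => s * x.2) A) = 0%E.
Proof.
move=> s1; apply: countable_xsections_null.
  apply: edge_borel2 => x; apply: cvgM; [exact: cvg_cst|exact: cvg_snd].
move=> v; apply: separated_countable => u t t01.
have [s0|s0] : s = 1 \/ s = -1 by move: s1; case: ger0P; lra.
  move=> Eu; apply: (edge_shift t01 Eu) => a /=; rewrite s0.
  by case/andP: t01; nra.
move=> Eu Ev; apply: (edge_shift t01 Ev _ Eu) => a /=; rewrite s0.
by case/andP: t01; nra.
Qed.

Lemma Nclosed_setD_Nopen A : Nclosed A `\` Nopen A `<=`
  edge (fun x => 1 * x.1) A `|` edge (fun x => -1 * x.1) A `|`
  (edge (fun x => 1 * x.2) A `|` edge (fun x => -1 * x.2) A).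
Proof.
move=> x [[a Aa xa] Nx].
have d1 : dist x a = 1.
  by apply/eqP; rewrite eq_le xa leNgt/=; apply/negP => ?; apply: Nx; exists a.
have far phi : phi x < phi a - 2^-1 -> edge phi A x.
  by split=> // n _; exists a => //; split=> //; rewrite d1 ltrDl invr_gt0.
have : (x.1 - a.1) ^+ 2 + (x.2 - a.2) ^+ 2 = 1.
  by rewrite -[RHS](expr1n _ 2) -d1 sqr_sqrtr// addr_ge0// sqr_ge0.
have [?|?] := ltP x.1 (a.1 - 2^-1); first by left; left; apply: far; lra.
have [?|?] := ltP (a.1 + 2^-1) x.1; first by left; right; apply: far; lra.
have [?|?] := ltP x.2 (a.2 - 2^-1); first by right; left; apply: far; lra.
have [?|?] := ltP (a.2 + 2^-1) x.2; first by right; right; apply: far; lra.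
(* Otherwise both coordinate differences are at most 1/2, and the squared distance is at most 1/2
   instead of 1. *)
nra.
Qed.

Lemma Nclosed_lebesgue A : lebesgue_set R (Nclosed A).
Proof.
exists (Nopen A); first exact: open_borel2 (@open_Nopen R A).
apply: (@negligibleS _ (mR2 R) R _ _ _ (subset_trans _ (@Nclosed_setD_Nopen A))).
  by move=> x [//|[/Nopen_sub_Nclosed]].
have cfst (s : R) : continuous (fun x : R * R => s * x.1).
  by move=> x; apply: cvgM; [exact: cvg_cst|exact: cvg_fst].
have csnd (s : R) : continuous (fun x : R * R => s * x.2).
  by move=> x; apply: cvgM; [exact: cvg_cst|exact: cvg_snd].
apply: negligibleU; apply: negligibleU.
- exists (edge (fun x => 1 * x.1) A); split=> //; first exact: edge_borel2.
  by apply: edge_fst_null; rewrite normr1.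
- exists (edge (fun x => -1 * x.1) A); split=> //; first exact: edge_borel2.
  by apply: edge_fst_null; rewrite normrN normr1.
- exists (edge (fun x => 1 * x.2) A); split=> //; first exact: edge_borel2.
  by apply: edge_snd_null; rewrite normr1.
- exists (edge (fun x => -1 * x.2) A); split=> //; first exact: edge_borel2.
  by apply: edge_snd_null; rewrite normrN normr1.
Qed.

Lemma lebesgue_setU A U :
  lebesgue_set R A -> lebesgue_set R U -> lebesgue_set R (A `|` U).
Proof.
move=> [B mB nB] [V mV nV]; exists (B `|` V); first exact: (@measurableU _ (mR2 R)).
apply: negligibleS (negligibleU nB nV) => x /=.
by have [] := pselect (A x); have [] := pselect (U x);
   have [] := pselect (B x); have [] := pselect (V x); tauto.
Qed.

Lemma lebesgue_setD A U :
  lebesgue_set R A -> lebesgue_set R U -> lebesgue_set R (A `\` U).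
Proof.
move=> [B mB nB] [V mV nV]; exists (B `\` V); first exact: (@measurableD _ (mR2 R)).
apply: negligibleS (negligibleU nB nV) => x /=.
by have [] := pselect (A x); have [] := pselect (U x);
   have [] := pselect (B x); have [] := pselect (V x); tauto.
Qed.

Lemma closed_drawable_lebesgue U : closed_drawable R U -> lebesgue_set R U.
Proof.
move=> [n]; elim: n U => [|n IH] U /= => [[A ->]|[D [A [/IH LD ->]]]].
  exact: Nclosed_lebesgue.
have NA := Nclosed_lebesgue A.
by case: odd; [exact: lebesgue_setU|exact: lebesgue_setD].
Qed.

End Measurability.

(** * A Lebesgue set that is not closed-disk drawable *)

Section Drawability.
Variable R : realType.
Local Notation dist := (@Defs.edist R).
Implicit Types (x y a : R * R) (A U D : set (R * R)).

Lemma Nclosed1_sub A a : A a -> Nclosed [set a] `<=` Nclosed A.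
Proof. by move=> Aa x [_ -> xa]; exists a. Qed.

Lemma not_closed_drawable U :
  (forall a, ~ Nclosed [set a] `<=` U) ->
  (forall a, ~ Nclosed [set a] `<=` ~` U) -> ~ closed_drawable R U.
Proof.
move=> dU dCU [n]; elim: n U dU dCU => [|n IH] U dU dCU /=.
  (* A set drawn in one step without containing a disk is empty, so its complement contains the disk
     about the origin. *)
  move=> [A UA]; apply: (dCU (0, 0)) => x _; rewrite UA => -[a Aa _].
  by apply: (dU a); rewrite UA; exact: Nclosed1_sub.
move=> [D [A [lD UE]]]; suff A0 : Nclosed A = set0.
  by apply: (IH U) => //; rewrite UE A0 setU0 setD0 if_same.
apply/seteqP; split=> // x [a Aa _]; move: UE; case: odd => UE.
  by apply: (dU a); rewrite UE => y /(Nclosed1_sub Aa); right.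
by apply: (dCU a); rewrite UE => y /(Nclosed1_sub Aa) NA [].
Qed.

Definition integer_lines : set (R * R) := fst @^-1` range (fun k : int => k%:~R).

Lemma integer_lines_lebesgue : lebesgue_set R integer_lines.
Proof.
exists integer_lines; last by rewrite setDv setU0; exact: negligible_set0.
rewrite /borel2 -[X in measurable X]setTI.
apply: (@measurable_fst _ _ (measurableTypeR R) (measurableTypeR R)) => //.
apply: countable_measurable => //.
exact: sub_countable (card_image_le _ _) (countableP _).
Qed.

(** The horizontal diameter of a disk decides: the abscissas [a.1] and [a.1 + 2^-1] are not both
    integers, and the floor of [a.1] is within 1 of [a.1]. *)
Lemma integer_lines_not_closed_drawable : ~ closed_drawable R integer_lines.
Proof.
have in_disk a s : -1 <= s <= 1 -> Nclosed [set a] (a.1 + s, a.2).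
  move=> /andP[s0 s1]; exists a => //; rewrite edist_le//=.
  by rewrite expr1n subrr expr0n addrAC subrr add0r addr0; nra.
apply: not_closed_drawable => a da.
  have [|k _ /= ka] := da _ (in_disk a 0 _); first by lra.
  have [|l _ /= la] := da _ (in_disk a 2^-1 _); first by lra.
  have [] : (0 < (l - k)%:~R :> R) /\ ((l - k)%:~R < 1 :> R).
    by rewrite intrD rmorphN/= ka la; split; lra.
  rewrite ltr0z -[1]/(1%:~R) ltr_int; lia.
have /andP[] := real_floor_itv (num_real a.1); rewrite intrD => f1 f2.
apply: (da (a.1 + ((Num.floor a.1)%:~R - a.1), a.2)).
  by apply: in_disk; lra.
by exists (Num.floor a.1) => //=; rewrite addrC subrK.
Qed.

(** * Cardinalities of the two collections of drawable sets *)

Lemma set_line_card_le_closed_drawable : [set: set R] #<= closed_drawable R.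
Proof.
apply: (@injective_card_le _ _
  (fun T : set R => Nclosed [set x | T x.1 /\ x.2 = 0])); last first.
  by move=> T; exists 0%N; eexists.
(* The unit disk about [(s, 0)] meets the line at height 1 only in its top point [(s, 1)]. *)
have top (T : set R) t : Nclosed [set x | T x.1 /\ x.2 = 0] (t, 1) <-> T t.
  split=> [[[s z]/= [Ts ->]]|Tt].
    rewrite edist_le//= subr0 expr1n gerDr => ts.
    have : (t - s) ^+ 2 = 0 by apply/eqP; rewrite eq_le ts sqr_ge0.
    by move/eqP; rewrite sqrf_eq0 subr_eq0 => /eqP ->.
  by exists (t, 0) => //; rewrite edist_le//= subrr subr0 expr0n add0r.
by move=> T S TS; apply/funext => t; apply/propext; rewrite -top TS top.
Qed.

Lemma set_plane_card_le_closed_drawable : [set: set (R * R)] #<= closed_drawable R.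
Proof.
have [f fI] := plane_embeds_in_line R.
apply: card_le_trans set_line_card_le_closed_drawable.
exact: injective_card_le (injective_image fI) _.
Qed.

Definition open_of_code (c : set nat) : set (R * R) :=
  \bigcup_(q in [set q | c (pickle q)]) rat_rect q.

(** Follows the recursion of [Dlevel]. Only [s 0] to [s n] are read; infinite sequences give the
    codes of all levels one common type. *)
Fixpoint drawable_of_code (n : nat) (s : nat -> set nat) : set (R * R) :=
  match n with
  | 0 => open_of_code (s 0%N)
  | m.+1 => if odd m then drawable_of_code m s `|` open_of_code (s m.+1)
            else drawable_of_code m s `\` open_of_code (s m.+1)
  end.

Lemma eq_drawable_of_code n s1 s2 : (forall i, (i <= n)%N -> s1 i = s2 i) ->
  drawable_of_code n s1 = drawable_of_code n s2.
Proof.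
elim: n => [|n IH] s12 /=; first by rewrite s12.
by rewrite s12// IH// => i /leqW; exact: s12.
Qed.

Lemma Nopen_code A : exists c, Nopen A = open_of_code c.
Proof.
exists (pickle @` [set q | rat_rect q `<=` Nopen A]).
rewrite [LHS](open_rat_rect (@open_Nopen R A)); congr bigcup.
by apply/funext => q; rewrite -[LHS](image_inj (pcan_inj pickleK)).
Qed.

Lemma drawable_code U : drawable R U -> exists n s, U = drawable_of_code n s.
Proof.
move=> [n nU]; exists n; elim: n U nU => [|n IH] U /=.
  by move=> [A ->]; have [c ->] := Nopen_code A; exists (fun=> c).
move=> [D [A [/IH[s ->] ->]]]; have [c ->] := Nopen_code A.
exists (fun i => if i == n.+1 then c else s i); rewrite eqxx.
rewrite (@eq_drawable_of_code n (fun i => _) s)// => i.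
by case: eqP => // ->; rewrite ltnn.
Qed.

Lemma drawable_card_le_line : drawable R #<= [set: R].
Proof.
pose code := [set: nat * (nat -> set nat)].
apply: (@card_le_trans _ _ _ code).
  apply: card_le_trans (card_image_le (fun p => drawable_of_code p.1 p.2) code).
  apply: subset_card_le => U /drawable_code[n [s ->]].
  by exists (n, s).
(* Packs a code into one subset of a countable type: the level as a singleton on the left, the
   sequence as a relation on the right. *)
pose g (p : nat * (nat -> set nat)) := [set z : nat + nat * nat |
  match z with inl n => n = p.1 | inr ij => p.2 ij.1 ij.2 end].
apply: (@injective_card_le _ _ (fun p => ternary R (pickle @` g p))) => //.
move=> [n s] [m r] /ternary_inj/injective_pickle e; congr (_, _).
  have : g (n, s) (inl n) by [].
  by rewrite e.
by apply/funext => i; apply/funext => j; exact: (congr1 (fun S => S (inr (i, j))) e).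
Qed.

End Drawability.

Theorem theorem1p3 (R : realType) :
  (forall S, closed_drawable R S -> lebesgue_set R S) /\
  (exists S, lebesgue_set R S /\ ~ closed_drawable R S) /\
  (closed_drawable R #= lebesgue_set R) /\
  (drawable R #<= closed_drawable R /\ ~ (closed_drawable R #<= drawable R)).
Proof.
(* Any collection of plane sets lies in the full power set; this bounds both the Lebesgue sets and
   the drawable sets. *)
have all_le (X : set (set (R * R))) : X #<= closed_drawable R.
  apply: card_le_trans (set_plane_card_le_closed_drawable R).
  exact: subset_card_le.
split; first exact: closed_drawable_lebesgue.
split.
  exists (@integer_lines R); split; first exact: integer_lines_lebesgue.
  exact: integer_lines_not_closed_drawable.
split.
  rewrite card_eq_le all_le andbT; apply: subset_card_le.
  exact: closed_drawable_lebesgue.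
(* Under [le], the power set of the line would inject into the line through the two drawable
   collections. *)
split=> // le; apply: (@Cantor R).
apply: card_le_trans (set_line_card_le_closed_drawable R) _.
exact: card_le_trans le (drawable_card_le_line R).
Qed.
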